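(* Let $D$ be a $d$-regular digraph on $n$ vertices $v_1,\dots,v_n$, and let $\{H_1,H_2,\dots,H_d\}$ be a dicycle factorization of $D$. Let $M(H_i)$ denote the $n\times n$ adjacency matrix of $H_i$ with respect to the ordering $v_1,\dots,v_n$ (the same ordering for all $i$). Then there is a labeling of $V(\overrightarrow{L}D)$ (that is, a bijection from the vertices of the line digraph $\overrightarrow{L}D$ to $\{1,\dots,dn\}$) such that the adjacency matrix of $\overrightarrow{L}D$ with respect to this labeling is the matrix product $$M(\overrightarrow{L}D)=(J_d\otimes I_n)\cdot\bigoplus_{i=1}^{d}M(H_i).$$
   Context: A digraph $D=(V,A)$ consists of a non-empty finite set $V(D)$ of vertices and a finite set $A(D)$ of ordered pairs of vertices called arcs; there are no multiple arcs, and loops $(v,v)$ are allowed. Given a bijective labeling (ordering) $v_1,\dots,v_n$ of the vertices, the adjacency matrix $M(D)$ is the $n\times n$ $(0,1)$-matrix with $M_{i,j}(D)=1$ if $(v_i,v_j)\in A(D)$ and $M_{i,j}(D)=0$ otherwise. A digraph $D$ is $d$-regular if every vertex $v\in V(D)$ has in-degree $|\{u:(u,v)\in A(D)\}|=d$ and out-degree $|\{u:(v,u)\in A(D)\}|=d$. A subdigraph $H$ of $D$ is a digraph with $V(H)\subseteq V(D)$ and $A(H)\subseteq A(D)$; it is a factor (spanning subdigraph) of $D$ if $V(H)=V(D)$. A dicycle factor of $D$ is a factor $H$ of $D$ such that $M(H)$ is a permutation matrix. A decomposition of $D$ is a set of subdigraphs of $D$ whose arc-sets are exactly the classes of a partition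 of $A(D)$. A dicycle factorization of $D$ is a decomposition of $D$ all of whose members are dicycle factors of $D$. The line digraph $\overrightarrow{L}D$ of $D$ has vertex-set $A(D)$; for arcs $(v_h,v_i),(v_j,v_k)\in A(D)$, the pair $((v_h,v_i),(v_j,v_k))$ is an arc of $\overrightarrow{L}D$ if and only if $v_i=v_j$. $I_n$ is the $n\times n$ identity matrix and $J_d$ is the $d\times d$ all-ones matrix. $\otimes$ denotes the Kronecker product of matrices (so $J_d\otimes I_n$ is the $dn\times dn$ matrix consisting of $d\times d$ blocks each equal to $I_n$), and $\bigoplus$ denotes the direct sum of matrices (so $\bigoplus_{i=1}^d M(H_i)$ is the $dn\times dn$ block-diagonal matrix with diagonal blocks $M(H_1),\dots,M(H_d)$ in this order). *)

(* Defs.v *)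
From HB Require Import structures.
From mathcomp Require Import all_boot all_order all_algebra.
From mathcomp Require Export mxtens.

Set Implicit Arguments.
Unset Strict Implicit.
Unset Printing Implicit Defensive.

Import GRing.Theory.
Local Open Scope ring_scope.

(* A digraph whose vertices are drawn from an ambient finite type T, encoded as
   the pair (vertex set, arc set), so that a digraph and its subdigraphs live in
   the same type. The null digraph is not excluded here, so that the line
   digraph is a total operation; non-emptiness of the vertex set is required
   separately. *)
Record digraph (T : finType) : predArgType := Digraph {
  digraph_val : {set T} * {set T * T};
  _ : digraph_val.2 \subset setX digraph_val.1 digraph_val.1 }.

HB.instance Definition _ (T : finType) := [isSub for @digraph_val T].
HB.instance Definition _ (T : finType) := [Finite of digraph T by <:].

Definition vset (T : finType) (D : digraph T) : {set T} := (digraph_val D).1.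
Definition arcs (T : finType) (D : digraph T) : {set T * T} := (digraph_val D).2.

(* v lists the elements of V as v_0, ..., v_(n-1), each exactly once; the
   labeling "V -> {1, ..., n}" is its inverse. *)
Definition labeling (T : finType) (V : {set T}) (n : nat) (v : 'I_n -> T) : Prop :=
  injective v /\ [set v i | i : 'I_n] = V.

Definition adjmx (T : finType) (D : digraph T) (n : nat) (v : 'I_n -> T) : 'M[int]_n :=
  \matrix_(i, j) ((v i, v j) \in arcs D)%:R.

Definition regular (T : finType) (d : nat) (D : digraph T) : Prop :=
  forall x, x \in vset D ->
    #|[set u | (u, x) \in arcs D]| = d /\ #|[set u | (x, u) \in arcs D]| = d.

Definition subdigraph (T : finType) (H D : digraph T) : bool :=
  [&& vset H != set0, vset H \subset vset D & arcs H \subset arcs D].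

Definition factor (T : finType) (H D : digraph T) : bool :=
  subdigraph H D && (vset H == vset D).

(* Being a permutation matrix does not depend on the ordering of V(H). *)
Definition dicycle_factor (T : finType) (H D : digraph T) : Prop :=
  factor H D /\
  forall (n : nat) (v : 'I_n -> T), labeling (vset H) v -> is_perm_mx (adjmx H v).

(* Distinct members have distinct arc sets: members correspond to classes. *)
Definition decomposition (T : finType) (F : {set digraph T}) (D : digraph T) : Prop :=
  [/\ {in F, forall H, subdigraph H D},
      {in F &, injective (@arcs T)}
    & partition [set arcs H | H in F] (arcs D)].

Definition dicycle_factorization (T : finType) (F : {set digraph T}) (D : digraph T) : Prop :=
  decomposition F D /\ {in F, forall H, dicycle_factor H D}.

Definition line_arcs (T : finType) (D : digraph T) : {set (T * T) * (T * T)} :=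
  [set p | [&& p.1 \in arcs D, p.2 \in arcs D & p.1.2 == p.2.1]].

Lemma line_arcs_sub (T : finType) (D : digraph T) :
  line_arcs D \subset setX (arcs D) (arcs D).
Proof. by apply/subsetP => -[a b]; rewrite !inE /= => /and3P[-> ->]. Qed.

Definition line_digraph (T : finType) (D : digraph T) : digraph (T * T)%type :=
  @Digraph (T * T)%type (arcs D, line_arcs D) (line_arcs_sub D).

Lemma sum_ord_const (d n : nat) : (\sum_(i < d) n = d * n)%N.
Proof. by rewrite sum_nat_const card_ord. Qed.

(* \mxdiag, with its size \sum_(i < d) n rewritten as d * n. *)
Definition mxdirsum (d n : nat) (B : 'I_d -> 'M[int]_n) : 'M[int]_(d * n) :=
  castmx (sum_ord_const d n, sum_ord_const d n) (\mxdiag_(i < d) B i).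

(* Main.v *)
(** Label the arcs of [D] by pairs [(j, l)], where the pair [(j, l)] stands for
    the unique arc of [H j] with head [v l]. The arc labelled [(i, k)] has head
    [v k], so in the line digraph it precedes the arc labelled [(j, l)] exactly
    when [(v k, v l)] is an arc of [H j], whatever [i] is; this is also the
    corresponding entry of the matrix product. *)
Require Import Defs.
From mathcomp Require Import all_boot all_order all_algebra.
From mathcomp Require Import perm.
Set Implicit Arguments.
Unset Strict Implicit.
Unset Printing Implicit Defensive.
Local Open Scope ring_scope.

Import GRing.Theory.

(** Kronecker and block indexing agree: both send [(i, k)] to [i * n + k], the [i] blocks before
    block [i] having total size [i * n]. *)
Lemma cast_mxtens_index (d n : nat) (i : 'I_d) (k : 'I_n) :
  cast_ord (esym (sum_ord_const d n)) (mxtens_index (i, k)) =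
  tagnat.Rank (p_ := fun=> n) i k.
Proof.
apply: val_inj; rewrite [RHS]tagnat.RankEsum /=.
by rewrite -(big_ord_widen d (fun=> n)) ?sum_ord_const // ltnW.
Qed.

Lemma mxdirsumE (d n : nat) (B : 'I_d -> 'M[int]_n) i j k l :
  mxdirsum B (mxtens_index (i, k)) (mxtens_index (j, l)) =
  if i == j then B j k l else 0.
Proof.
rewrite castmxE !cast_mxtens_index.
(* The family given here is the one that defines [\mxdiag]. *)
have /matrixP/(_ k l) := mxblockK (p_ := fun=> n) (q_ := fun=> n)
  (fun i j => if i == j then conform_mx 0 (B i) else 0) i j.
rewrite mxE => ->; case: eqP => [->|_]; last by rewrite mxE.
by rewrite conform_mx_id.
Qed.

(** Row [(i, k)] of the Kronecker factor has its ones at the indices [(j', k)]; only [j' = j] meets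
    block [j], so [i] drops out. *)
Lemma tens_ones_mul_mxdirsumE (d n : nat) (B : 'I_d -> 'M[int]_n) i j k l :
  (((const_mx 1 : 'M[int]_d) *t (1%:M : 'M[int]_n)) *m mxdirsum B)
    (mxtens_index (i, k)) (mxtens_index (j, l)) = B j k l.
Proof.
rewrite mxE (bigD1 (mxtens_index (j, k))) //= tensmxE mxdirsumE !mxE !eqxx !mul1r.
rewrite big1 ?addr0 // => a; case: (mxtens_indexP a) => i' k' ne.
rewrite tensmxE mxdirsumE !mxE mul1r; case: eqP => [ek|_]; last by rewrite mul0r.
case: eqP => [ei|_]; last by rewrite mulr0.
by rewrite ek ei eqxx in ne.
Qed.

Lemma arcsP (T : finType) (D : digraph T) a :
  a \in arcs D -> a.1 \in vset D /\ a.2 \in vset D.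
Proof. by move/(subsetP (valP D)); rewrite inE => /andP. Qed.

Lemma dicycle_factor_perm (T : finType) (H D : digraph T) (n : nat)
    (v : 'I_n -> T) :
  dicycle_factor H D -> labeling (vset D) v ->
  exists s : 'S_n, forall k l, ((v k, v l) \in arcs H) = (k == s l).
Proof.
move=> [/andP[_ /eqP VH] perm_H] lab_v.
have /is_perm_mxP[s /matrixP Es] : is_perm_mx (adjmx H v).
  by apply: perm_H; rewrite VH.
(* [perm_mx s] sends tails to heads; the inverse gives the tail of the arc with head [v l]. *)
exists (s^-1)%g => k l; have := Es k l; rewrite !mxE => /eqP.
rewrite Num.Theory.eqr_nat (canF_eq (permK s)).
by case: (_ \in arcs H); case: (k == _).
Qed.

Theorem mainTheorem1 (T : finType) (D : digraph T) (d n : nat) (v : 'I_n -> T)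
    (H : 'I_d -> digraph T)
    (hD : vset D != set0)
    (hv : labeling (vset D) v)
    (hreg : regular d D)
    (hinj : injective H)
    (hH : dicycle_factorization [set H i | i : 'I_d] D) :
  exists w : 'I_(d * n) -> T * T,
    labeling (vset (line_digraph D)) w /\
    adjmx (line_digraph D) w =
      ((const_mx 1 : 'M[int]_d) *t (1%:M : 'M[int]_n))
        *m mxdirsum (fun i => adjmx (H i) v).
Proof.
have [[_ inj_arcs /and3P[/eqP covD trivD _]] facH] := hH.
have HF j : H j \in [set H i | i : 'I_d] by apply: imset_f.
have /fin_all_exists[s sE] j := dicycle_factor_perm (facH _ (HF j)) hv.
have [inj_v im_v] := hv.
pose arc j l := (v (s j l), v l).
have arcH j l : arc j l \in arcs (H j) by rewrite sE eqxx.
have arcD j l : arc j l \in arcs D.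
  by rewrite -covD; apply/bigcupP; exists (arcs (H j)); rewrite ?imset_f.
pose w a := arc (mxtens_unindex a).1 (mxtens_unindex a).2.
have wE j l : w (mxtens_index (j, l)) = arc j l by rewrite /w mxtens_indexK.
exists w.
split; last first.
  apply/matrixP => a b.
  case: (mxtens_indexP a) (mxtens_indexP b) => i k [j l].
  (* Both entries reduce to [k == s j l]. *)
  by rewrite tens_ones_mul_mxdirsumE !mxE !wE inE /= !arcD sE inj_eq.
split.
  move=> a b; case: (mxtens_indexP a) (mxtens_indexP b) => i k [j l].
  rewrite !wE => eq_arc; have [_ /inj_v ->] := eq_arc.
  (* The heads already agree. The common arc lies in two classes of a partition, which must then
     coincide. *)
  suff /inj_arcs/hinj-> : arcs (H i) = arcs (H j) by [].
  apply/eqP/negPn/negP => neq.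
  have /trivIsetP/(_ _ _ (imset_f _ (HF i)) (imset_f _ (HF j)) neq) := trivD.
  by move/disjointFr/(_ (arcH i k)); rewrite eq_arc arcH.
rewrite -[vset _]/(arcs D); apply/setP => -[x y].
apply/imsetP/idP => [[a _ ->]|xyD]; first exact: arcD.
have [/= xV yV] := arcsP xyD.
(* Surjectivity: the class containing [(x, y)] gives [j], and its head [y] gives [l]. *)
move: xyD xV yV; rewrite -im_v -covD.
case/bigcupP => _ /imsetP[_ /imsetP[j _ ->] ->] xyH.
case/imsetP=> k _ Ex /imsetP[l _ Ey]; exists (mxtens_index (j, l)) => //.
by rewrite wE /arc; move: xyH; rewrite Ex Ey sE => /eqP <-.
Qed.
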